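(* Let $A$ be an $n\times n$ complex matrix. Suppose that every eigenpair of $A$ is an eigenpair of $A^*$; that is, for every $\lambda\in\mathbb{C}$ and every nonzero $v\in\mathbb{C}^n$, $$Av=\lambda v \quad\Rightarrow\quad A^*v=\lambda v.$$ Then $A$ is Hermitian, that is, $A^*=A$ (thus all eigenvalues of $A$ are real).
   Context: $A^*$ denotes the conjugate transpose of $A$. An eigenpair of an $n\times n$ matrix $M$ is a pair $(\lambda,v)$ with $\lambda\in\mathbb{C}$, $v\in\mathbb{C}^n$ nonzero, and $Mv=\lambda v$. *)

(* Defs.v *)
From mathcomp Require Import all_boot all_order all_algebra.

Set Implicit Arguments.
Unset Strict Implicit.
Unset Printing Implicit Defensive.

Import GRing.Theory.
Local Open Scope ring_scope.

(* Right eigenpairs, acting on column vectors: MathComp's [eigenvalue] and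
   [eigenspace] are about row vectors instead. *)
Definition eigenpair (C : numClosedFieldType) (n : nat) (M : 'M[C]_n)
    (lambda : C) (v : 'cV[C]_n) : Prop :=
  v != 0 /\ M *m v = lambda *: v.

(* Main.v *)
(** By Schur's theorem [A] is unitarily similar to a lower triangular matrix
    [T], which inherits the hypothesis on eigenpairs. The last column of [T] is
    a multiple of the last basis vector, which is thus an eigenvector of [T],
    hence of [T^t*] for the same eigenvalue; so the last row of [T] is diagonal
    with a real diagonal entry. Going up row by row, [T] is real diagonal. *)
Require Import Defs.
From mathcomp Require Import all_boot all_order all_algebra.
From mathcomp Require Import reals complex.

Set Implicit Arguments.
Unset Strict Implicit.
Unset Printing Implicit Defensive.

Import Order.TTheory GRing.Theory Num.Theory.
Local Open Scope ring_scope.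
Local Open Scope complex_scope.
Local Open Scope sesquilinear_scope.

Lemma trmxC_mul (C : numClosedFieldType) m n p
    (A : 'M[C]_(m, n)) (B : 'M_(n, p)) : (A *m B) ^t* = B ^t* *m A ^t*.
Proof. by rewrite trmx_mul map_mxM. Qed.

Lemma eigenpair_col (C : numClosedFieldType) n (T : 'M[C]_n) (j : 'I_n) :
  (forall k, k != j -> T k j = 0) -> eigenpair T (T j j) (delta_mx j 0).
Proof.
move=> Tj; split.
  apply/eqP => /matrixP /(_ j 0) /eqP.
  by rewrite !mxE !eqxx oner_eq0.
rewrite -colE; apply/matrixP => k z; rewrite !mxE (ord1 z) eqxx andbT.
by case: (eqVneq k j) => [-> | /Tj ->]; rewrite ?mulr1 ?mulr0.
Qed.

Lemma eigenpair_unitary (C : numClosedFieldType) n (P T : 'M[C]_n) l v :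
  P \is unitarymx ->
  eigenpair (P ^t* *m T *m P) l v <-> eigenpair T l (P *m v).
Proof.
move=> Pu; have PPt : P *m P ^t* = 1%:M by apply/unitarymxP.
have PtP : P ^t* *m P = 1%:M by apply: mulmx1C.
have Pinj : injective (mulmx P : 'cV_n -> 'cV_n).
  by move=> x y /(congr1 (mulmx (P ^t*))); rewrite !mulmxA PtP !mul1mx.
have Pv0 : (P *m v != 0) = (v != 0) by rewrite -(inj_eq Pinj v) mulmx0.
rewrite /eigenpair Pv0; split=> -[v0 Tv]; split=> //.
  by rewrite scalemxAr -Tv !mulmxA PPt mul1mx.
by apply: Pinj; rewrite -scalemxAr -Tv !mulmxA PPt mul1mx.
Qed.

(** Evaluating [v ^t* *m A *m v] from the right gives [l] times [v ^t* *m v]; from the left, through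
    the adjoint, it gives the conjugate of [l] times the same nonzero scalar. *)
Lemma eigenpair_adjoint_real (C : numClosedFieldType) n (A : 'M[C]_n) l v :
  eigenpair A l v -> eigenpair (A ^t*) l v -> l \is Num.real.
Proof.
move=> [v0 Av] [_ Atv]; apply/CrealP.
(* [dotmx] pairs row vectors, so positivity is applied to [v ^t*]. *)
have vv : (v ^t* *m v) 0 0 != 0.
  have vt0 : v ^t* != 0.
    by apply: contraNneq v0 => vt0; rewrite -(trmxCK v) vt0 trmx0 map_mx0.
  by have := dotmx_is_dotmx vt0; rewrite dotmxE trmxCK => /lt0r_neq0.
have vAv : (l^*)%R *: (v ^t* *m v) = l *: (v ^t* *m v).
  by rewrite scalemxAl -map_mxZ -linearZ -Atv trmxC_mul trmxCK -mulmxA Av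
             -scalemxAr.
by apply: (mulIf vv); have /matrixP/(_ 0 0) := vAv; rewrite !mxE.
Qed.

Lemma trig_eigenpair_adjoint (C : numClosedFieldType) n (T : 'M[C]_n) :
  is_trig_mx T ->
  (forall l v, eigenpair T l v -> eigenpair (T ^t*) l v) -> T ^t* = T.
Proof.
move=> /is_trig_mxP trigT hT.
(* Downward induction on rows: the bound says that [j] is among the last [m], and [m = n] reaches
   all. The equation is entry [i] of [T ^t*] applied to the [j]-th basis vector; at [i = j] it makes
   [T j j] real. *)
have rowT m (j : 'I_n) : (n <= j + m)%N ->
    forall i, ((T j i)^*)%R = T j j * (i == j)%:R.
  elim: m j => [|m IHm] j lejm i; first by rewrite addn0 leqNgt ltn_ord in lejm.
  (* Above the diagonal this is triangularity; below it, row [k] is already known to be diagonal. *)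
  have colT k : k != j -> T k j = 0.
    rewrite neq_ltn => /orP[/trigT // | ltjk].
    apply/eqP; rewrite -conjC_eq0 IHm; last first.
      by rewrite (leq_trans lejm) // addnS -addSn leq_add2r.
    by rewrite -val_eqE ltn_eqF // mulr0.
  have [_] := hT _ _ (eigenpair_col colT).
  by rewrite -colE => /matrixP /(_ i 0); rewrite !mxE eqxx andbT.
have {}rowT j i : ((T j i)^*)%R = T j j * (i == j)%:R by apply: rowT (leq_addl _ _) i.
apply/matrixP => i j; rewrite !mxE rowT.
have [-> | neij] := eqVneq i j; first by rewrite mulr1.
by apply/esym/eqP; rewrite mulr0 -conjC_eq0 rowT (eq_sym j) (negPf neij) mulr0.
Qed.

Lemma eigenpair_adjoint_hermitian (C : numClosedFieldType) n (A : 'M[C]_n) :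
  (forall l v, eigenpair A l v -> eigenpair (A ^t*) l v) -> A ^t* = A.
Proof.
(* [Schur] asks for a positive size. *)
case: (posnP n) => [n0 | n_gt0] hA.
  by apply/matrixP => i; have := ltn_ord i; rewrite {2}n0.
have [P Pu] := Schur A n_gt0.
rewrite -[similar_trig P A]/(is_trig_mx (conjmx P A)) conjymx // => trigT.
set T := P *m A *m P ^t* in trigT.
have PtP : P ^t* *m P = 1%:M by apply/mulmx1C/unitarymxP.
have AE : A = P ^t* *m T *m P by rewrite !mulmxA PtP mul1mx -mulmxA PtP mulmx1.
have AtE : A ^t* = P ^t* *m T ^t* *m P.
  by rewrite {1}AE !trmxC_mul trmxCK mulmxA.
rewrite AtE (trig_eigenpair_adjoint trigT) // => l v.
(* In this form an eigenpair of [T] passes to [A], then by [hA] to [A ^t*], and back to [T ^t*]. *)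
have -> : v = P *m (P ^t* *m v).
  by rewrite mulmxA; have /unitarymxP -> := Pu; rewrite mul1mx.
by move=> /(eigenpair_unitary _ _ _ Pu); rewrite -AE => /hA; rewrite AtE
   => /(eigenpair_unitary _ _ _ Pu).
Qed.

Theorem theorem2 (R : realType) (n : nat) (A : 'M[R[i]]_n)
  (hA : forall (lambda : R[i]) (v : 'cV[R[i]]_n),
      eigenpair A lambda v -> eigenpair (A ^t*) lambda v) :
  A ^t* = A /\
  (forall (lambda : R[i]) (v : 'cV[R[i]]_n),
      eigenpair A lambda v -> lambda \is Num.real).
Proof.
split; first exact: eigenpair_adjoint_hermitian hA.
by move=> l v Av; apply: eigenpair_adjoint_real Av (hA _ _ Av).
Qed.
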